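(* Let $H$ be a separable infinite-dimensional complex Hilbert space, let $K(H)$ be the Banach algebra of compact operators on $H$ with the operator norm, and let $F(H)\subset K(H)$ be the ideal of finite-rank bounded operators on $H$. Then: (i) every derivation $D: K(H)\to F(H)$ is inner and implemented by an element of $F(H)$, i.e. there exists $x\in F(H)$ such that $D(a)=ax-xa$ for all $a\in K(H)$; and (ii) there exist derivations $D: K(H)\to K(H)$ that are not inner in $K(H)$, i.e. for which there is no $x\in K(H)$ with $D(a)=ax-xa$ for all $a\in K(H)$.
   Context: For a Banach algebra $A$ and an ideal $I$ of $A$ (possibly $I=A$), a derivation $D: A\to I$ is a bounded linear map satisfying $D(ab)=aD(b)+D(a)b$ for all $a,b\in A$; here $I=F(H)$ is regarded with the operator norm inherited from $K(H)$. A derivation $D:A\to I$ is inner, implemented by $x\in I$, if $D(a)=ax-xa$ for all $a\in A$. *)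

(* Defs.v *)
From HB Require Import structures.
From mathcomp Require Import all_boot all_order all_algebra.
From mathcomp Require Import all_classical all_reals all_analysis.
From mathcomp Require Import complex.
Set Implicit Arguments.
Unset Strict Implicit.
Unset Printing Implicit Defensive.
Import Order.TTheory GRing.Theory Num.Theory.
Import numFieldNormedType.Exports.
Local Open Scope classical_set_scope.
Local Open Scope ring_scope.
Local Open Scope complex_scope.

Definition separable (T : topologicalType) : Prop :=
  exists2 S : set T, countable S & dense S.

Definition lin_span (K : nzRingType) (V : lmodType K) (n : nat)
    (e : 'I_n -> V) : set V :=
  [set v | exists c : 'I_n -> K, v = \sum_(i < n) c i *: e i].

Definition finite_dim (K : nzRingType) (V : lmodType K) (A : set V) : Prop :=
  exists (n : nat) (e : 'I_n -> V), A = lin_span e.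

Section Operators.
Context {R : realType} {H : normedModType R[i]}.

Definition bounded_op : set (H -> H) :=
  [set a | linear a /\ exists M : R, forall u, `|a u| <= M%:C * `|u|].

Definition compact_op : set (H -> H) :=
  [set a | bounded_op a /\ precompact (a @` [set u | `|u| <= 1])].

Definition finite_rank_op : set (H -> H) :=
  [set a | bounded_op a /\ finite_dim (range a)].

(* The norm of a module over R[i] takes its values in R[i]; [complex.Re] reads
   this (real, nonnegative) value in R, where suprema exist. Since [sup] is 0
   on unbounded sets, [opnorm a] is meaningful only when [a] is bounded. *)
Definition opnorm (a : H -> H) : R :=
  sup [set complex.Re `|a u| | u in [set u | `|u| <= 1]].

(* Only the restriction of [D] to [A] matters; the product of operators is
   composition. *)
Definition derivation (A I : set (H -> H)) (D : (H -> H) -> (H -> H)) : Prop :=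
  [/\ set_fun A I D,
      forall (c : R[i]) (a b : H -> H), A a -> A b ->
        D (c *: a + b) = c *: D a + D b,
      exists M : R, forall a, A a -> opnorm (D a) <= M * opnorm a
    & forall a b, A a -> A b -> D (a \o b) = (a \o D b) + (D a \o b)].

Definition inner_derivation (A I : set (H -> H)) (D : (H -> H) -> (H -> H)) : Prop :=
  exists2 x, I x & forall a, A a -> D a = (a \o x) - (x \o a).

End Operators.

Arguments compact_op {R} H.
Arguments finite_rank_op {R} H.

(* Main.v *)
(* (i) A derivation into bounded operators is D a = a x - x a, with x read off
   from the values D (u e^* ) e.  If no x - c has finite rank, then x is not
   locally scalar modulo any finite-dimensional space, so one can choose u_n
   outside F_n = span {u_j, x u_j : j < n} with x u_n outside span (u_n, F_n), and
   e_n orthogonal to u_n and F_n but not to x u_n.  For the compact operator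
   a = sum_n u_n e_n^* (with small e_n), (a x - x a) u_k is a nonzero multiple of
   u_k modulo F_k, so D a has infinite rank; hence some x - c has finite rank.
   (ii) Let T be the projection onto the even-indexed vectors of an orthonormal
   sequence and D a = a T - T a.  If x implements D, then T - x commutes with
   all rank-one operators, so it is a scalar c; a compact x = T - c forces both
   c = 1 (even vectors) and c = 0 (odd vectors). *)
Require Import Defs.
From HB Require Import structures.
From mathcomp Require Import all_boot all_order all_algebra.
From mathcomp Require Import all_classical all_reals all_analysis.
From mathcomp Require Import complex ring.
Import Order.TTheory GRing.Theory Num.Theory.
Import numFieldNormedType.Exports.
Local Open Scope classical_set_scope.
Local Open Scope ring_scope.

Set Implicit Arguments.
Unset Strict Implicit.
Unset Printing Implicit Defensive.

(** * Finitely spanned subspaces *)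

Section Span.
Context {K : fieldType} {V : lmodType K}.
Implicit Types (s t : seq V) (u v w : V) (A : set V).

Definition linear_subspace A := A 0 /\ forall (c : K) u v, A u -> A v -> A (c *: u + v).

(** Recursion on the list isolates one coefficient at a time, so inductions on generators need no
    indexed sums. *)
Fixpoint seq_span s : set V :=
  if s is x :: s' then [set v | exists c : K, seq_span s' (v - c *: x)] else [set 0].

Lemma subspaceZ A (c : K) u : linear_subspace A -> A u -> A (c *: u).
Proof. by case=> A0 AL Au; rewrite -[c *: u]addr0; exact: AL. Qed.

Lemma subspaceD A u v : linear_subspace A -> A u -> A v -> A (u + v).
Proof. by case=> _ AL Au Av; rewrite -[u]scale1r; exact: AL. Qed.

Lemma subspaceB A u v : linear_subspace A -> A u -> A v -> A (u - v).
Proof. by case=> _ AL Au Av; rewrite addrC -scaleN1r; exact: AL. Qed.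

Lemma subspace_sum A (I : Type) (r : seq I) (P : pred I) (F : I -> V) :
  linear_subspace A -> (forall i, P i -> A (F i)) -> A (\sum_(i <- r | P i) F i).
Proof.
move=> sA AF; elim/big_ind: _ => //; first by case: sA.
by move=> u v Au Av; exact: subspaceD.
Qed.

Lemma span_subspace s : linear_subspace (seq_span s).
Proof.
elim: s => [|x s [s0 sL]] /=.
  by split=> // c u v -> ->; rewrite scaler0 addr0.
split=> [|c u v [a au] [b bv]]; first by exists 0; rewrite scale0r subr0.
exists (c * a + b); rewrite scalerDl -scalerA opprD addrACA -scalerBr.
exact: sL.
Qed.

Lemma span_cons x s v : seq_span s v -> seq_span (x :: s) v.
Proof. by move=> sv; exists 0; rewrite scale0r subr0. Qed.

Lemma span_mem s v : v \in s -> seq_span s v.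
Proof.
elim: s => // x s IH; rewrite inE => /predU1P[->|/IH]; last exact: span_cons.
by exists 1; rewrite scale1r subrr; case: (span_subspace s).
Qed.

Lemma span_min s A : linear_subspace A -> {in s, forall v, A v} -> seq_span s `<=` A.
Proof.
move=> sA; elim: s => [|x s IH] As v /=; first by move->; case: sA.
case=> c /IH Av; rewrite -(subrK (c *: x) v); apply: subspaceD => //.
  by apply: Av => w ws; apply: As; rewrite inE ws orbT.
by apply: subspaceZ => //; apply: As; rewrite mem_head.
Qed.

Lemma spanS s t : {in s, forall v, seq_span t v} -> seq_span s `<=` seq_span t.
Proof. by apply: span_min; exact: span_subspace. Qed.

Lemma lin_spanE n (e : 'I_n -> V) : lin_span e = seq_span (codom e).
Proof.
rewrite eqEsubset; split=> [v [c ->]|].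
  apply: subspace_sum => [|i _]; first exact: span_subspace.
  by apply: subspaceZ; [exact: span_subspace|apply: span_mem; exact: codom_f].
apply: span_min; last first.
  move=> v /codomP[i ->]; exists (fun j => (j == i)%:R).
  rewrite (bigD1 i)//= eqxx scale1r big1 ?addr0// => j /negbTE ->.
  by rewrite scale0r.
split=> [|c u v [a ->] [b ->]].
  by exists (fun=> 0); rewrite big1// => i _; rewrite scale0r.
exists (fun i => c * a i + b i); rewrite scaler_sumr -big_split /=.
by apply: eq_bigr => i _; rewrite scalerDl scalerA.
Qed.

Lemma finite_dimE A : finite_dim A <-> exists s, A = seq_span s.
Proof.
split=> [[n [e ->]]|[s ->]]; first by exists (codom e); exact: lin_spanE.
exists (size s), (tnth (in_tuple s)); rewrite lin_spanE; congr seq_span.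
by rewrite /codom /image_mem map_tnth_enum.
Qed.

(** By induction on [s]: the part of [A] inside the span of the tail is finitely spanned, and at
    most one further generator [w] is needed, since multiples of [w] can clear the coefficient of
    [x]. *)
Lemma subspace_span A s :
  linear_subspace A -> A `<=` seq_span s -> exists t, A = seq_span t.
Proof.
elim: s A => [|x s IH] A sA As.
  exists [::]; rewrite eqEsubset; split=> // v /= ->; by case: sA.
have sB : linear_subspace (A `&` seq_span s).
  have [A0 AL] := sA; have [s0 sL] := span_subspace s.
  split=> [//|c u v [Au su] [Av sv]]; split; [exact: AL|exact: sL].
have [t Bt] := IH _ sB (@subIsetr _ _ _).
have [Asub|] := pselect (A `<=` seq_span s).
  by exists t; rewrite -Bt; apply/esym/setIidl.
move=> /existsNP[w /not_implyP[Aw nsw]]; exists (w :: t).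
have [c /= cw] := As _ Aw.
have c0 : c != 0 by apply/eqP => c0; move: cw; rewrite c0 scale0r subr0.
rewrite eqEsubset; split=> v.
  move=> Av; have [d /= dv] := As _ Av.
  (* The coefficients of [x] in [v] and [w] are [d] and [c], so this multiple of [w] cancels [x]. *)
  exists (d / c); rewrite -Bt; split.
    by apply: subspaceB => //; exact: subspaceZ.
  have -> : v - (d / c) *: w = v - d *: x - (d / c) *: (w - c *: x).
    by rewrite scalerBr scalerA divfK// opprB addrA subrK.
  apply: subspaceB; [exact: span_subspace|exact: dv|].
  by apply: subspaceZ => //; exact: span_subspace.
case=> d; rewrite -Bt => -[Av _]; rewrite -(subrK (d *: w) v).
by apply: subspaceD => //; exact: subspaceZ.
Qed.

Lemma linear_range_subspace (f : V -> V) : linear f -> linear_subspace (range f).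
Proof.
move=> fL; split=> [|c _ _ [u _ <-] [v _ <-]].
  by exists 0 => //; have := fL (-1) 0 0; rewrite !scaleN1r oppr0 addr0 addNr.
by exists (c *: u + v) => //; exact: fL.
Qed.

(** Among [n.+1] vectors in a space with [n] generators there is a linear relation; solving it for
    its last vector contradicts the freeness of [g]. *)
Lemma independent_sequence_unbounded (g : nat -> V) s :
  (forall k, ~ seq_span (mkseq g k) (g k)) -> ~ (forall k, seq_span s (g k)).
Proof.
move=> gfree gs.
have [n [e se]] : finite_dim (seq_span s) by apply/finite_dimE; exists s.
have /choice[c gE] : forall k, exists c : 'I_n -> K, g k = \sum_(i < n) c i *: e i.
  by move=> k; have := gs k; rewrite se.
pose C : 'M[K]_(n.+1, n) := \matrix_(k, i) c k i.
(* [C] has one more row than columns, so its rows are dependent. *)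
have kerC : kermx C != 0.
  rewrite kermx_eq0 /row_free; apply/eqP => rC.
  by have := rank_leq_col C; rewrite rC ltnn.
have [j wj] : exists j, row j (kermx C) != 0.
  apply/existsP; apply: contraNT kerC; rewrite negb_exists => /forallP w0.
  by apply/eqP/row_matrixP => j; rewrite row0; apply/eqP; have := w0 j; rewrite negbK.
have : row j (kermx C) *m C = 0 by rewrite -row_mul mulmx_ker row0.
move: (row j _) wj => w wj wC.
have [k0 wk0] : exists k, w 0 k != 0.
  apply/existsP; apply: contraNT wj; rewrite negb_exists => /forallP w0.
  by apply/eqP/rowP => k; rewrite mxE; apply/eqP; have := w0 k; rewrite negbK.
have sum0 : \sum_(k < n.+1) w 0 k *: g k = 0.
  under eq_bigr do rewrite gE scaler_sumr.
  rewrite exchange_big big1//= => i _.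
  under eq_bigr do rewrite scalerA.
  rewrite -scaler_suml; have /matrixP/(_ 0 i) := wC; rewrite !mxE => wCi.
  rewrite (eq_bigr (fun k => w 0 k * C k i)) => [|k _]; last by rewrite mxE.
  by rewrite wCi scale0r.
(* [k] is the largest index with a nonzero coefficient, so the relation expresses [g k] through
   earlier terms. *)
case: (@arg_maxnP _ k0 (fun k => w 0 k != 0) val wk0) => k wk kmax.
apply: (gfree k).
have -> : g k = - ((w 0 k)^-1 *: (\sum_(l < n.+1 | l != k) w 0 l *: g l)).
  move: sum0; rewrite (bigD1 k)//= => /eqP; rewrite addr_eq0 => /eqP wg.
  by rewrite -scalerN -wg scalerA mulVf// scale1r.
rewrite -scaleN1r; do 2! (apply: subspaceZ; first exact: span_subspace).
apply: subspace_sum => [|l lk]; first exact: span_subspace.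
have [->|wl] := eqVneq (w 0 l) 0.
  by rewrite scale0r; case: (span_subspace (mkseq g k)).
apply: subspaceZ; first exact: span_subspace.
apply: span_mem; apply/mapP; exists (l : nat) => //.
by rewrite mem_iota add0n ltn_neqAle lk; exact: kmax.
Qed.

(* A locally scalar map modulo a subspace F is scalar modulo F: compare the
   scalars at two vectors independent modulo F through their sum. *)
Lemma locally_scalar_mod_span (x : V -> V) s : linear x ->
    (forall t, exists v, ~ seq_span t v) ->
    (forall u, ~ seq_span s u -> seq_span (u :: s) (x u)) ->
  exists c : K, forall u, seq_span s (x u - c *: u).
Proof.
move=> xL Vinf xs; have [u0 u0s] := Vinf s.
have [c0 c0P] := xs _ u0s; exists c0.
have sS := span_subspace s.
have xD u v : x (u + v) = x u + x v by have := xL 1 u v; rewrite !scale1r.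
have H v : ~ seq_span (u0 :: s) v -> seq_span s (x v - c0 *: v).
  move=> v0s; have vs : ~ seq_span s v by move=> /(@span_cons u0).
  have [c cP] := xs _ vs.
  have [|d dP] := xs (u0 + v).
    move=> uv; apply: v0s; exists (-1); rewrite scaleN1r opprK addrC.
    exact: uv.
  have key : seq_span s ((c0 - d) *: u0 + (c - d) *: v).
    have -> : (c0 - d) *: u0 + (c - d) *: v =
        x (u0 + v) - d *: (u0 + v) - (x u0 - c0 *: u0) - (x v - c *: v).
      have sub a b b' : (a - b) - (a - b') = b' - b :> V.
        by rewrite opprB addrC addrA subrK.
      have -> : x (u0 + v) - d *: (u0 + v) = (x u0 - d *: u0) + (x v - d *: v).
        by rewrite xD scalerDr opprD addrACA.
      by rewrite -[RHS]addrA addrACA !sub !scalerBl.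
    by do 2! apply: subspaceB => //.
  have cd : c = d.
    apply/eqP; rewrite -subr_eq0; apply: contraPT v0s => cd; rewrite not_notE.
    exists (- ((c - d)^-1 * (c0 - d))); rewrite scaleNr opprK addrC.
    rewrite -[v]scale1r -(mulVf cd) -!scalerA -scalerDr.
    exact: subspaceZ.
  have /eqP cd0 : c0 = d.
    apply: contrapT => /eqP; rewrite -subr_eq0 => cd0; apply: u0s.
    rewrite -[u0]scale1r -(mulVf cd0) -scalerA; apply: subspaceZ => //.
    by move: key; rewrite cd subrr scale0r addr0.
  by rewrite (eqP cd0) -cd.
move=> v; have [vs|/H//] := pselect (seq_span (u0 :: s) v).
(* For [v] in the span of [u0 :: s], both [w] and [w + v] lie outside it, so [H] applies to them and
   the difference gives the claim for [v]. *)
have [w ws] := Vinf (u0 :: s).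
have -> : x v - c0 *: v = x (w + v) - c0 *: (w + v) - (x w - c0 *: w).
  by rewrite xD scalerDr [- (c0 *: w + _)]opprD addrACA [RHS]addrC addKr.
apply: subspaceB => //; apply: H => // => wv; apply: ws.
by rewrite -(addrK v w); apply: subspaceB => //; exact: span_subspace.
Qed.

End Span.

(** The history is built as a list [b n] of the first [n] choices, and the next choice is read off
    from it. *)
Lemma sequential_choice (T : Type) (P : seq T -> T -> Prop) :
  (forall s, exists x, P s x) -> exists f : nat -> T, forall n, P (mkseq f n) (f n).
Proof.
move=> /boolp.choice[g gP].
pose b := fix b n := if n is m.+1 then rcons (b m) (g (b m)) else [::].
exists (g \o b) => n; have -> : mkseq (g \o b) n = b n; last exact: gP.
by elim: n => // n IH; rewrite mkseqS IH.
Qed.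

(** * Precompact sets in normed spaces *)

Section PrecompactSets.
Context {K : numFieldType}.

Lemma lipschitz_continuous (V W : normedModType K) (f : V -> W) (k : K) :
  0 <= k -> (forall x y, `|f x - f y| <= k * `|x - y|) -> continuous f.
Proof.
move=> k0 fk x; apply/cvgrPdist_le => e e0.
(* Dividing by [k + 1] also covers [k = 0]. *)
have d0 : 0 < e / (k + 1) by rewrite divr_gt0// ltr_wpDl.
have : \forall y \near x, `|x - y| <= e / (k + 1) by exact: cvgr_dist_le.
apply: filterS => y xy; apply: (le_trans (fk _ _)).
rewrite (le_trans (ler_wpM2l k0 xy))// mulrCA ler_piMr ?(ltW e0)//.
by rewrite ler_pdivrMr ?ltr_wpDl// mul1r lerDl.
Qed.

Lemma precompactP (V : normedModType K) (S : set V) :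
  precompact S <-> exists2 A, compact A & S `<=` A.
Proof.
split=> [[A SA [cA _]]|[A cA SA]]; first by exists A.
apply: (precompact_subset SA); exact: compact_precompact.
Qed.

Lemma precompact_image (V W : normedModType K) (f : V -> W) (S : set V) :
  continuous f -> precompact S -> precompact (f @` S).
Proof.
move=> fc /precompactP[A cA SA]; apply/precompactP; exists (f @` A).
  apply: continuous_compact => //; exact: continuous_subspaceT.
exact: image_subset.
Qed.

Lemma precompact_add (V : normedModType K) (S1 S2 : set V) :
  precompact S1 -> precompact S2 ->
  precompact [set v | exists2 p, S1 p.1 /\ S2 p.2 & v = p.1 + p.2].
Proof.
move=> /precompactP[A cA SA] /precompactP[B cB SB]; apply/precompactP.
exists ((fun p => p.1 + p.2) @` (A `*` B)).
  apply: continuous_compact; last exact: compact_setX.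
  apply: continuous_subspaceT => p.
  by apply: cvgD; [exact: cvg_fst|exact: cvg_snd].
by move=> v [p [p1 p2] ->]; exists p => //; split; [exact: SA|exact: SB].
Qed.

(** An ultrafilter on the closure of [S] is shown to be Cauchy: moved into a nearby compact set [A]
    it has a cluster point [p], and a small ball around [p] must belong to the ultrafilter.
    Completeness then provides the limit. *)
Lemma precompact_approx (V : completeNormedModType K) (S : set V) :
  (forall e : K, 0 < e -> exists2 A, compact A &
     forall v, S v -> exists2 w, A w & `|v - w| <= e) -> precompact S.
Proof.
move=> Sapprox; rewrite precompactE compact_ultra => F FU FS.
have FP := @ultra_proper _ _ FU.
suff /cauchy_cvgP/cvg_ex[p Fp] : cauchy F.
  exists p; split => //.
  exact: (@closed_cvg _ _ F _ id _ (@closed_closure _ S)).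
apply/cauchyP => e e0.
have e4 : 0 < e / 2 / 2 by rewrite !divr_gt0.
have [A cA SA] := Sapprox _ e4.
(* [g] moves a point of the closure into [A] at distance at most [e / 2]: one quarter of [e] to
   reach [S], another to reach [A]. The last quarter needed below is the distance from [g v] to
   [p]. *)
have /boolp.choice[g gP] :
    forall v, exists w, closure S v -> A w /\ `|v - w| <= e / 2 / 2 + e / 2 / 2.
  move=> v; have [vS|] := pselect (closure S v); last by exists 0.
  have [u [uS vu]] := vS _ (nbhsx_ballx v _ e4).
  have [w Aw uw] := SA _ uS; exists w => _; split=> //.
  rewrite -(subrKA u) (le_trans (ler_normD _ _))// lerD// ltW//.
  by move: vu; rewrite -ball_normE.
have gFA : F (g @^-1` A).
  by apply: (filterS _ FS) => v vS; exact: (gP v vS).1.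
have [p [Ap pF]] := cA (g x @[x --> F]) _ gFA.
(* If the complement of the ball were in the ultrafilter, its image under [g] would still come close
   to [p], which the distances exclude. *)
exists p; have [//|Fnp] := in_ultra_setVsetC (ball p e) FU.
have FgB : F (g @^-1` [set g v | v in closure S `&` ~` ball p e]).
  by apply: filterS (filterI FS Fnp) => v Sv; exists v.
have [_ [[v [Sv vp] <-] pv]] := pF _ _ FgB (nbhsx_ballx p _ e4).
exfalso; apply: vp; move: pv; rewrite -!ball_normE /= => pv.
rewrite -(subrKA (g v)) (le_lt_trans (ler_normD _ _))//.
have {}vg := (gP _ Sv).2; rewrite distrC in vg.
rewrite (lt_le_trans (ltr_leD pv vg))// -splitr [leRHS]splitr lerD2r.
by rewrite [leRHS]splitr lerDr ltW.
Qed.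

End PrecompactSets.

(** * Bounded and compact operators *)

Section CompactOperators.
Context {R : realType} {H : completeNormedModType R[i]}.
Implicit Types (a b f : H -> H) (u v : H).

Definition linear_map {a} (aL : linear a) : {linear H -> H} :=
  HB.pack a (GRing.isLinear.Build _ _ _ _ a aL).

Lemma linear_fun0 a : linear a -> a 0 = 0.
Proof. by move=> aL; exact: (linear0 (linear_map aL)). Qed.

Lemma linear_funZ a (c : R[i]) u : linear a -> a (c *: u) = c *: a u.
Proof. by move=> aL; exact: (linearZ_LR (linear_map aL)). Qed.

Lemma linear_funB a u v : linear a -> a (u - v) = a u - a v.
Proof. by move=> aL; exact: (linearB (linear_map aL)). Qed.

Lemma linear_fun_sum a n (F : 'I_n -> H) : linear a ->
  a (\sum_(i < n) F i) = \sum_(i < n) a (F i).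
Proof. by move=> aL; exact: (linear_sum (linear_map aL)). Qed.

Lemma realcD (x y : R) : (x + y)%:C%C = x%:C%C + y%:C%C.
Proof. exact: rmorphD. Qed.

Lemma realcM (x y : R) : (x * y)%:C%C = x%:C%C * y%:C%C.
Proof. exact: rmorphM. Qed.

Lemma normRe u : (complex.Re `|u|)%:C%C = `|u|.
Proof. by rewrite RRe_real// normr_real. Qed.

Lemma bounded_opP a : bounded_op a <->
  linear a /\ exists2 M : R, 0 <= M & forall u, `|a u| <= M%:C%C * `|u|.
Proof.
split=> -[aL]; last by case=> M _ aM; split=> //; exists M.
case=> M aM; split=> //; exists `|M| => // u; apply: (le_trans (aM u)).
by apply: ler_wpM2r => //; rewrite lecR ler_norm.
Qed.

Lemma bounded_op_continuous a : bounded_op a -> continuous a.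
Proof.
move=> /bounded_opP[aL [M M0 aM]].
apply: (@lipschitz_continuous _ H H a M%:C%C); first by rewrite lecR.
by move=> x y; rewrite -linear_funB.
Qed.

Lemma bounded_op_comp a b : bounded_op a -> bounded_op b -> bounded_op (a \o b).
Proof.
move=> /bounded_opP[aL [M M0 aM]] /bounded_opP[bL [N N0 bN]].
split=> [c u v|]; first by rewrite /= bL aL.
exists (M * N) => u /=; rewrite (le_trans (aM _))// realcM -mulrA.
by apply: ler_wpM2l => //; rewrite lecR.
Qed.

Lemma bounded_op_lin (c : R[i]) a b :
  bounded_op a -> bounded_op b -> bounded_op (c *: a + b).
Proof.
move=> /bounded_opP[aL [M M0 aM]] /bounded_opP[bL [N N0 bN]].
split=> [d u v|].
  have E w : (c *: a + b) w = c *: a w + b w by [].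
  by rewrite !E aL bL !scalerDr !scalerA (mulrC d) addrACA.
exists (complex.Re `|c| * M + N) => u.
rewrite (le_trans (ler_normD _ _))// realcD mulrDl lerD//.
rewrite realcM RRe_real ?normr_real// -mulrA normrZ.
exact: ler_wpM2l.
Qed.

Lemma bounded_op_id : bounded_op (@idfun H).
Proof. by split=> //; exists 1 => u; rewrite mul1r. Qed.

Lemma compact_op_lin (c : R[i]) a b :
  compact_op H a -> compact_op H b -> compact_op H (c *: a + b).
Proof.
move=> [aB aK] [bB bK]; split; first exact: bounded_op_lin.
have cK : precompact ((fun v => c *: v) @` (a @` [set u | `|u| <= 1])).
  apply: precompact_image aK; apply: (@lipschitz_continuous _ H H _ `|c|) => // x y.
  by rewrite -scalerBr normrZ.
apply: precompact_subset (precompact_add cK bK) => _ [u u1 <-].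
exists (c *: a u, b u) => //; split; last by exists u.
by exists (a u) => //; exists u.
Qed.

Lemma compact_op_compl a b :
  bounded_op a -> compact_op H b -> compact_op H (a \o b).
Proof.
move=> aB [bB bK]; split; first exact: bounded_op_comp.
apply: precompact_subset (precompact_image (bounded_op_continuous aB) bK).
by move=> _ [u u1 <-]; exists (b u) => //; exists u.
Qed.

(** [b] maps the unit ball into the ball of radius [M + 1], so its image under [a] is a dilate of
    part of the precompact image of the unit ball. The added [1] keeps the radius invertible. *)
Lemma compact_op_compr a b :
  compact_op H a -> bounded_op b -> compact_op H (a \o b).
Proof.
move=> [aB aK] bB; split; first exact: bounded_op_comp.
have [aL _] := aB; have [bL [M M0 bM]] := (bounded_opP _).1 bB.
have M1 : 0 < M%:C%C + 1 :> R[i] by rewrite ltr_wpDl// lecR.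
have cK : precompact ((fun v => (M%:C%C + 1) *: v) @` (a @` [set u | `|u| <= 1])).
  apply: precompact_image aK.
  apply: (@lipschitz_continuous _ H H _ (M%:C%C + 1)); first exact: ltW.
  by move=> x y; rewrite -scalerBr normrZ gtr0_norm.
apply: precompact_subset cK => _ [u u1 <-] /=.
exists (a ((M%:C%C + 1)^-1 *: b u)).
  exists ((M%:C%C + 1)^-1 *: b u) => //=.
  rewrite normrZ normfV gtr0_norm// mulrC ler_pdivrMr// mul1r.
  rewrite (le_trans (bM u))// -[leRHS]mulr1 ler_pM//; first by rewrite lecR.
  by rewrite lerDl.
by rewrite -linear_funZ// scalerA mulfV ?gt_eqF// scale1r.
Qed.

Lemma compact_op_approx a : bounded_op a ->
  (forall e : R[i], 0 < e -> exists2 b, compact_op H b &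
     forall u, `|u| <= 1 -> `|a u - b u| <= e) -> compact_op H a.
Proof.
move=> aB ab; split=> //; apply: precompact_approx => e e0.
have [b [bB /precompactP[A cA bA]] abe] := ab _ e0; exists A => // _ [u u1 <-].
by exists (b u); [apply: bA; exists u|exact: abe].
Qed.

(* The image of the unit ball is covered by the compact set of the vectors
   (x + i y) w with x and y in a fixed segment. *)
Lemma compact_op_line a (w : H) (M : R) : 0 <= M -> linear a ->
    (forall u, exists2 c : R[i], a u = c *: w & `|c| <= M%:C%C * `|u|) ->
  compact_op H a.
Proof.
move=> M0 aL aw; split.
  split=> //; exists (M * complex.Re `|w|) => u; have [c -> cM] := aw u.
  by rewrite normrZ realcM RRe_real ?normr_real// mulrAC ler_wpM2r.
have segc (v : H) : precompact [set (x%:C%C : R[i]) *: v | x in `[- M, M]].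
  apply/precompactP; exists [set (x%:C%C : R[i]) *: v | x in `[- M, M]] => //.
  apply: continuous_compact; last exact: segment_compact.
  apply: continuous_subspaceT => x; apply/cvgrPdist_le => e e0.
  have eE : e = (complex.Re e)%:C%C by rewrite RRe_real// gtr0_real.
  have e'0 : 0 < complex.Re e by rewrite -ltcR -eE.
  set k := complex.Re `|v|.
  have k0 : 0 <= k by rewrite -lecR normRe; exact: normr_ge0.
  have d0 : 0 < complex.Re e / (k + 1) by rewrite divr_gt0// ltr_wpDl.
  have : \forall y \near x, `|x - y| <= complex.Re e / (k + 1).
    by apply/nbhs_ballP; exists (complex.Re e / (k + 1)) => // y /ltW.
  apply: filterS => y xy; rewrite -scalerBl normrZ.
  rewrite -(rmorphB (real_complex R)) normc_def /=.
  rewrite expr0n addr0 sqrtr_sqr -normRe -realcM eE lecR -/k.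
  rewrite (le_trans (ler_wpM2r k0 xy))// mulrAC ler_pdivrMr ?ltr_wpDl//.
  by rewrite ler_wpM2l ?(ltW e'0)// lerDl.
apply: precompact_subset (precompact_add (segc w) (segc (Complex 0 1 *: w))).
move=> _ [u u1 <-]; have [c -> cM] := aw u.
have {}cM : `|c| <= M%:C%C by rewrite (le_trans cM)// ler_piMr// lecR.
have cRe : `|complex.Re c| <= M by rewrite -lecR (le_trans (normc_ge_Re c)).
have cIm : `|complex.Im c| <= M.
  rewrite -lecR (le_trans _ cM)// normc_def lecR -sqrtr_sqr ler_wsqrtr//.
  by rewrite lerDr sqr_ge0.
exists ((complex.Re c)%:C%C *: w, (complex.Im c)%:C%C *: (Complex 0 1 *: w)).
  split; [exists (complex.Re c)|exists (complex.Im c)] => //;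
    by rewrite /= in_itv/= -ler_norml.
rewrite /= scalerA -scalerDl; congr (_ *: _).
by rewrite [LHS]complexE mulrC.
Qed.

(** Normalising [u] reduces this to the unit ball; boundedness of [a] makes [sup] a genuine upper
    bound there. *)
Lemma opnormP a u : bounded_op a -> `|a u| <= (opnorm a)%:C%C * `|u|.
Proof.
move=> /bounded_opP[aL [M M0 aM]].
have [->|u0] := eqVneq u 0; first by rewrite linear_fun0// !normr0 mulr0.
have nu : 0 < `|u| by rewrite normr_gt0.
have uE : u = `|u| *: (`|u|^-1 *: u) by rewrite scalerA mulfV ?gt_eqF// scale1r.
rewrite {1}uE linear_funZ// normrZ normr_id mulrC ler_wpM2r// -(normRe (a _)) lecR.
apply: ub_le_sup; last first.
  by exists (`|u|^-1 *: u) => //=; rewrite normrZ normfV normr_id mulVf// gt_eqF.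
exists M => _ [v v1 <-]; rewrite -lecR normRe (le_trans (aM v))//.
by rewrite ler_piMr// lecR.
Qed.

Lemma opnorm_le a (M : R) : 0 <= M -> (forall u, `|a u| <= M%:C%C * `|u|) ->
  opnorm a <= M.
Proof.
move=> M0 aM; apply: ge_sup.
  by exists (complex.Re `|a 0|), 0 => //=; rewrite normr0.
move=> _ [v v1 <-]; rewrite -lecR normRe (le_trans (aM v))//.
by rewrite ler_piMr// lecR.
Qed.

Lemma opnorm_ge0 a : bounded_op a -> 0 <= opnorm a.
Proof.
move=> /bounded_opP[aL [M M0 aM]]; apply: ub_le_sup; last first.
  by exists 0 => /=; rewrite ?normr0// linear_fun0// normr0.
exists M => _ [v v1 <-]; rewrite -lecR normRe (le_trans (aM v))//.
by rewrite ler_piMr// lecR.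
Qed.

End CompactOperators.

(** * Limits of sequences of vectors and operators *)

Section SequenceLimits.
Context {R : realType} {H : completeNormedModType R[i]}.

Lemma cvg_dist_le (f : nat -> H) (l v : H) (N : nat) (r : R[i]) :
    f n @[n --> \oo] --> l -> (forall n, (N <= n)%N -> `|v - f n| <= r) ->
  `|v - l| <= r.
Proof.
move=> fl vf; apply/ler_addgt0Pr => e e0.
have [M _ lf] : \forall n \near \oo, `|f n - l| <= e by exact: cvgr_distC_le.
rewrite -(subrKA (f (maxn N M))) (le_trans (ler_normD _ _))// lerD//.
  by apply: vf; exact: leq_maxl.
by apply: lf; exact: leq_maxr.
Qed.

Lemma cvg_eventually_eq (f : nat -> H) (l v : H) (N : nat) :
  f n @[n --> \oo] --> l -> (forall n, (N <= n)%N -> f n = v) -> l = v.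
Proof.
move=> fl fv; apply/eqP; rewrite eq_sym -subr_eq0 -normr_le0.
by apply: (cvg_dist_le (N := N) fl) => n /fv ->; rewrite subrr normr0.
Qed.

Lemma cauchy_seq_cvg (f : nat -> H) :
    (forall e : R[i], 0 < e ->
       exists N, forall n, (N <= n)%N -> `|f n - f N| <= e) ->
  exists l : H, f n @[n --> \oo] --> l.
Proof.
move=> fC; exists (limn f); apply: cauchy_cvg; apply/cauchyP => e e0.
have [N fN] := fC _ (divr_gt0 e0 (ltr0n _ 2)).
exists (f N); exists N => // n /= /fN.
rewrite -ball_normE /= distrC => /le_lt_trans; apply.
by rewrite [ltRHS]splitr ltrDl divr_gt0.
Qed.

(** Both numbers are real, so the claim is read in [R], where it follows from the Archimedean
    property and [n < 2 ^ n]. *)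
Lemma pow2_inv_small (M e : R[i]) : 0 <= M -> 0 < e -> exists n, 2 ^- n * M <= e.
Proof.
move=> M0 e0.
have ME : (complex.Re M)%:C%C = M by rewrite RRe_real// ger0_real.
have eE : (complex.Re e)%:C%C = e by rewrite RRe_real// gtr0_real.
have e'0 : 0 < complex.Re e by rewrite -ltcR eE.
have M'0 : 0 <= complex.Re M by rewrite -lecR ME.
have := archi_boundP (divr_ge0 M'0 (ltW e'0)).
set n := Num.bound _ => Mn; exists n.
rewrite mulrC ler_pdivrMr ?exprn_gt0// -ME -eE -(rmorph_nat (real_complex R) 2).
rewrite -rmorphXn -rmorphM lecR mulrC -ler_pdivrMr// (le_trans (ltW Mn))//.
by rewrite -natrX ler_nat ltnW// ltn_expl.
Qed.

(** Linearity and the uniform bound pass to the limit. This produces both the compact series of part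
    (i) and the projection of part (ii). *)
Lemma pointwise_limit (S : nat -> H -> H) (M : R) :
    (forall n, linear (S n)) -> (forall n u, `|S n u| <= M%:C%C * `|u|) ->
    (forall u (e : R[i]), 0 < e ->
       exists N, forall n, (N <= n)%N -> `|S n u - S N u| <= e) ->
  exists T : H -> H,
    [/\ linear T, forall u, `|T u| <= M%:C%C * `|u|
      & forall u, S n u @[n --> \oo] --> T u].
Proof.
move=> SL SM SC.
have /boolp.choice[T ST] : forall u, exists l : H, S n u @[n --> \oo] --> l.
  by move=> u; exact/cauchy_seq_cvg/SC.
exists T; split=> // [c u v|u].
  have SE : (fun n => S n (c *: u + v)) = (c \*: S^~ u) + S^~ v.
    by apply/funext => n; rewrite SL.
  have Sl : S n (c *: u + v) @[n --> \oo] --> c *: T u + T v.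
    by rewrite SE; apply: cvgD => //; exact: cvgZl_tmp.
  exact: (cvg_unique (@norm_hausdorff _ H) (ST _) Sl).
rewrite -normrN -sub0r; apply: (cvg_dist_le (N := 0%N) (ST u)) => n _.
by rewrite sub0r normrN.
Qed.

End SequenceLimits.

(** * Orthogonality and rank-one operators *)

Section InnerProduct.
Context {R : realType} {H : completeNormedModType R[i]}.
Variable dot : {dot H for Num.conj}.
Hypothesis norm_dot : forall u : H, `|u| ^+ 2 = dot u u.
Implicit Types (u v w : H).

Lemma dotC u v : dot u v = Num.conj (dot v u).
Proof. by rewrite hermC expr0 mul1r. Qed.

(** The projection [c *: v] of [u] onto the line of [v] is no longer than [u], by Pythagoras. *)
Lemma cauchy_schwarz u v : `|dot u v| <= `|u| * `|v|.
Proof.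
have [->|v0] := eqVneq v 0; first by rewrite linear0r normr0 mulr_ge0.
have vv : dot v v != 0 by rewrite dnorm_eq0.
set c := dot u v / dot v v; set w := u - c *: v.
have wv : dot w v = 0 by rewrite linearBl linearZl_LR /= divfK// subrr.
have wcv : dot w (c *: v) = 0 by rewrite linearZr_LR /= wv mulr0.
have : `|c *: v| <= `|u|.
  rewrite -(@ler_pXn2r _ 2)// ?nnegrE// !norm_dot.
  by rewrite -[u in leRHS](subrK (c *: v)) -/w hnormDd// lerDr dnorm_ge0.
rewrite normrZ normrM normfV -norm_dot normrX normr_id expr2 invfM.
rewrite mulrA mulfVK ?normr_eq0// ler_pdivrMr// normr_gt0//.
Qed.

(** One Gram-Schmidt step per generator: [y] is the part of [x] orthogonal to the span of [s], and
    the projection of [v] gains the component of [v] along [y]. *)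
Lemma span_projection s v :
  exists2 w, seq_span s w & forall t, seq_span s t -> dot t (v - w) = 0.
Proof.
elim: s v => [|x s IH] v; first by exists 0 => // t ->; rewrite linear0l.
have [x0 x0s xP] := IH x; have [v0 v0s vP] := IH v.
pose y := x - x0.
have ys t : seq_span s t -> dot y t = 0 by move=> ts; rewrite dotC xP// conjC0.
have [y0|y0] := eqVneq y 0.
  exists v0; first exact: span_cons.
  move=> t [c ct]; rewrite -(subrK (c *: x) t) linearDl /= vP//= add0r linearZl_LR /=.
  by rewrite -(subrK x0 x) -/y y0 add0r vP// mulr0.
have yy : dot y y != 0 by rewrite dnorm_eq0.
pose k := dot v y / dot y y.
exists (v0 + k *: y).
  exists k; rewrite /y scalerBr addrA addrAC addrK.
  by apply: subspaceB => //; [|apply: subspaceZ => //]; exact: span_subspace.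
have orth t : seq_span s t -> dot t (v - (v0 + k *: y)) = 0.
  move=> ts; rewrite opprD addrA linearBr /= vP// linearZr_LR /= (xP _ ts).
  by rewrite mulr0 subr0.
move=> t [c ct]; rewrite -(subrK (c *: x) t) linearDl /= orth//= add0r linearZl_LR /=.
rewrite -(subrK x0 x) -/y linearDl /= (orth x0)// addr0 opprD addrA !linearBr /=.
rewrite (ys v0)// mulr0 subr0 linearZr_LR /= /k rmorphM fmorphV /= -!dotC.
by rewrite divfK// subrr.
Qed.

Lemma span_separation s v : ~ seq_span s v ->
  exists2 e, (forall t, seq_span s t -> dot t e = 0) & dot v e != 0.
Proof.
move=> vs; have [w ws wP] := span_projection s v.
exists (v - w) => //; have -> : dot v (v - w) = dot (v - w) (v - w).
  by rewrite [RHS]linearBl /= (wP w)// subr0.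
by rewrite dnorm_eq0 subr_eq0; apply/eqP => vw; apply: vs; rewrite vw.
Qed.

Lemma dot_self_neq0 u v : dot u v != 0 -> v != 0.
Proof. by apply: contraNN => /eqP ->; rewrite linear0r. Qed.

(** The operator [w e^*]; the form [dot] is linear in its first argument. *)
Definition rank_one (w e u : H) : H := dot u e *: w.

Lemma rank_one_linear w e : linear (rank_one w e).
Proof. by move=> c u v; rewrite /rank_one linearPl scalerDl scalerA. Qed.

Lemma rank_one_compact w e : compact_op H (rank_one w e).
Proof.
apply: (@compact_op_line _ _ _ w (complex.Re `|e|)).
- by rewrite -lecR normRe; exact: normr_ge0.
- exact: rank_one_linear.
- by move=> u; exists (dot u e) => //; rewrite normRe mulrC cauchy_schwarz.
Qed.

Lemma rank_one_norm w e u : `|rank_one w e u| <= `|w| * `|e| * `|u|.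
Proof. by rewrite normrZ mulrC -mulrA ler_wpM2l// mulrC cauchy_schwarz. Qed.

Definition rank_one_sum (w e : nat -> H) (n : nat) (u : H) : H :=
  \sum_(k < n) rank_one (w k) (e k) u.

Lemma rank_one_sum0 (w e : nat -> H) u : rank_one_sum w e 0 u = 0.
Proof. exact: big_ord0. Qed.

Lemma rank_one_sumS (w e : nat -> H) n u :
  rank_one_sum w e n.+1 u = rank_one_sum w e n u + rank_one (w n) (e n) u.
Proof. by rewrite /rank_one_sum big_ord_recr. Qed.

Lemma rank_one_sum_compact (w e : nat -> H) n : compact_op H (rank_one_sum w e n).
Proof.
elim: n => [|n IH].
  have -> : rank_one_sum w e 0 = rank_one 0 0.
    by apply/funext => u; rewrite rank_one_sum0 /rank_one scaler0.
  exact: rank_one_compact.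
have -> : rank_one_sum w e n.+1 = 1 *: rank_one_sum w e n + rank_one (w n) (e n).
  by apply/funext => u; rewrite rank_one_sumS scale1r.
by apply: compact_op_lin => //; exact: rank_one_compact.
Qed.

Lemma rank_one_sum_linear (w e : nat -> H) n : linear (rank_one_sum w e n).
Proof. by have [[]] := rank_one_sum_compact w e n. Qed.

(** This evaluates an infinite series as a finite sum at vectors orthogonal to all late [e k]. *)
Lemma rank_one_sum_const (w e : nat -> H) m n u : (m <= n)%N ->
    (forall k, (m <= k)%N -> dot u (e k) = 0) ->
  rank_one_sum w e n u = rank_one_sum w e m u.
Proof.
move=> /subnK <- ue; elim: (n - m)%N => // d IH.
by rewrite addSn rank_one_sumS IH /rank_one ue ?leq_addl// scale0r addr0.
Qed.

(** * Norm-convergent series of rank-one operators *)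

Section AbsolutelySummable.
Variables w e : nat -> H.
Hypothesis we_small : forall n, `|w n| * `|e n| <= 2 ^- n.+1.

(** Keeping the exact geometric difference, instead of [2 ^- n] alone, lets the induction absorb
    each new term. *)
Lemma rank_one_sum_tail m n u : (n <= m)%N ->
  `|rank_one_sum w e m u - rank_one_sum w e n u| <= (2 ^- n - 2 ^- m) * `|u|.
Proof.
move=> /subnK <-; elim: (m - n)%N => [|d IH]; first by rewrite !subrr mul0r normr0.
rewrite addSn rank_one_sumS addrAC (le_trans (ler_normD _ _))//.
have -> : 2 ^- n - 2 ^- (d + n).+1 =
    (2 ^- n - 2 ^- (d + n)) + 2 ^- (d + n).+1 :> R[i].
  by rewrite [2 ^- (d + n)]splitr exprS invfM mulrC; ring.
rewrite mulrDl lerD// (le_trans (rank_one_norm _ _ _))//.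
by rewrite ler_wpM2r.
Qed.

(** The tail bound is uniform on the unit ball, so the limit is a norm limit of finite-rank compact
    operators. *)
Lemma rank_one_series_compact : exists2 a, compact_op H a &
  forall u, rank_one_sum w e n u @[n --> \oo] --> a u.
Proof.
have tail n u m : (n <= m)%N ->
    `|rank_one_sum w e m u - rank_one_sum w e n u| <= 2 ^- n * `|u|.
  move=> /rank_one_sum_tail/le_trans; apply; apply: ler_wpM2r => //.
  by rewrite gerBl invr_ge0 exprn_ge0.
have [||u e0 e00|a [aL aM ua]] := @pointwise_limit _ _ (rank_one_sum w e) 1.
- exact: rank_one_sum_linear.
- move=> n u; have := tail 0%N u n (leq0n _).
  by rewrite rank_one_sum0 subr0 expr0 invr1.
- have [N NP] := pow2_inv_small (normr_ge0 u) e00.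
  by exists N => n /tail /le_trans; apply.
exists a => //; apply: compact_op_approx; first by split=> //; exists 1.
move=> e0 e00; have [N NP] := pow2_inv_small ler01 e00.
exists (rank_one_sum w e N); first exact: rank_one_sum_compact.
move=> u u1; rewrite distrC; apply: (cvg_dist_le (N := N) (ua u)) => n Nn.
rewrite distrC (le_trans (tail _ _ _ Nn))// (le_trans _ NP)//.
by rewrite ler_wpM2l// invr_ge0 exprn_ge0.
Qed.

End AbsolutelySummable.

(** * Orthonormal sequences and their projections *)

Section OrthogonalSeries.
Variable h : nat -> H.
Hypothesis hP : forall i j, dot (h i) (h j) = (i == j)%:R.

Let P := rank_one_sum h h.

Lemma norm_orthonormal i : `|h i| = 1.
Proof. by apply/eqP; rewrite -(@eqrXn2 _ 2)// norm_dot hP eqxx expr1n. Qed.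

Lemma dot_partial_sum n u j :
  dot (P n u) (h j) = if (j < n)%N then dot u (h j) else 0.
Proof.
rewrite /P /rank_one_sum linear_sumlz.
under eq_bigr do rewrite /rank_one linearZl_LR /= hP.
case: ltnP => jn.
  rewrite (bigD1 (Ordinal jn))//= eqxx mulr1 big1 ?addr0// => i /negbTE.
  by rewrite -val_eqE /= => ->; rewrite mulr0.
by apply: big1 => i _; rewrite ltn_eqF ?mulr0// (leq_trans _ jn).
Qed.

Lemma dot_partial_sumr v n u :
  dot v (P n u) = \sum_(k < n) Num.conj (dot u (h k)) * dot v (h k).
Proof.
by rewrite /P /rank_one_sum linear_sumr; apply: eq_bigr => k _; rewrite linearZr_LR.
Qed.

Lemma pythagoras u v : dot u v = 0 -> `|u + v| ^+ 2 = `|u| ^+ 2 + `|v| ^+ 2.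
Proof. by move=> uv; rewrite !norm_dot hnormDd. Qed.

(** [P m u] and [P n u] have the same first [n] coefficients, so their difference is orthogonal to
    [P n u]. *)
Lemma partial_sum_increment m n u : (n <= m)%N ->
  `|P m u - P n u| ^+ 2 = `|P m u| ^+ 2 - `|P n u| ^+ 2.
Proof.
move=> nm; have orth : dot (P m u - P n u) (P n u) = 0.
  rewrite dot_partial_sumr big1// => k _.
  rewrite linearBl /= !dot_partial_sum ltn_ord (leq_trans (ltn_ord k) nm).
  by rewrite subrr mulr0.
by rewrite -[P m u in RHS](subrK (P n u)) (pythagoras orth) addrK.
Qed.

Lemma bessel n u : `|P n u| <= `|u|.
Proof.
rewrite -(@ler_pXn2r _ 2)// ?nnegrE//.
rewrite -[u in leRHS](subrK (P n u)) pythagoras ?lerDr ?exprn_ge0//.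
rewrite dot_partial_sumr big1// => k _.
by rewrite linearBl /= dot_partial_sum ltn_ord subrr mulr0.
Qed.

(** The squared norms of the partial sums are bounded by Bessel, and their differences are squared
    distances; an index nearly attaining the supremum therefore gives the Cauchy property. *)
Lemma orthogonal_series_bounded : exists T,
  [/\ linear T, forall u, `|T u| <= `|u| & forall u, P n u @[n --> \oo] --> T u].
Proof.
have [||u e e0|T [TL T1 PT]] := @pointwise_limit _ _ P 1.
- exact: rank_one_sum_linear.
- by move=> n u; rewrite mul1r bessel.
- pose q n := complex.Re (`|P n u| ^+ 2).
  have qE n : (q n)%:C%C = `|P n u| ^+ 2 by rewrite RRe_real// ger0_real// exprn_ge0.
  have eE : (complex.Re (e ^+ 2))%:C%C = e ^+ 2.
    by rewrite RRe_real// ger0_real// exprn_ge0// ltW.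
  have q_sup : has_sup (range q).
    split; first by exists (q 0%N), 0%N.
    exists (complex.Re (`|u| ^+ 2)) => _ [n _ <-].
    rewrite -lecR qE RRe_real ?ger0_real ?exprn_ge0//.
    by rewrite ler_pXn2r ?nnegrE// bessel.
  have e2 : 0 < complex.Re (e ^+ 2) by rewrite -ltcR eE exprn_gt0.
  have [_ [N _ <-] qN] := sup_adherent e2 q_sup.
  exists N => n Nn; rewrite -(@ler_pXn2r _ 2)// ?nnegrE ?(ltW e0)//.
  rewrite partial_sum_increment// -!qE -eE -(rmorphB (real_complex R)) lecR.
  rewrite lerBlDl; apply: le_trans (ltW _); last by rewrite -ltrBlDr; exact: qN.
  by apply: ub_le_sup; [exact: q_sup.2|exists n].
exists T; split=> // u; first by rewrite -[leRHS]mul1r.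
Qed.

(** The vectors [c *: h n] lie in a compact set and cluster at some [p]. For nonzero [c], two of
    them near [p] would give distinct [h n], [h m] at distance below [1], whereas the squared
    distance is [2]. *)
Lemma compact_op_eigenvalue (x : H -> H) (c : R[i]) :
  compact_op H x -> (forall n, x (h n) = c *: h n) -> c = 0.
Proof.
move=> [_ /precompactP[A cA xA]] xh; apply/eqP; apply: contraT => c0.
have c2 : 0 < `|c| / 2 by rewrite divr_gt0// normr_gt0.
have Axh : (x (h n) @[n --> \oo]) A.
  exists 0%N => // n _; apply: xA; exists (h n) => //=.
  by rewrite norm_orthonormal.
have [p [_ pC]] := cA _ _ Axh.
have near_p N : exists2 n, (N <= n)%N & `|p - c *: h n| < `|c| / 2.
  have AN : (x (h n) @[n --> \oo]) [set x (h n) | n in [set n | (N <= n)%N]].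
    by exists N => // n Nn; exists n.
  have [_ [[n Nn <-]]] := pC _ _ AN (nbhsx_ballx p _ c2).
  by rewrite -ball_normE /= xh => pn; exists n.
have [n _ pn] := near_p 0%N; have [m nm pm] := near_p n.+1.
have : `|h n - h m| < 1.
  rewrite -(ltr_pM2l (x := `|c|)) ?normr_gt0// -normrZ scalerBr mulr1.
  rewrite -(subrKA p) (le_lt_trans (ler_normD _ _))// [ltRHS]splitr ltrD//.
  by rewrite distrC.
rewrite -(@ltr_pXn2r _ 2)// ?nnegrE// pythagoras; last first.
  by rewrite linearNr /= hP ltn_eqF// oppr0.
by rewrite normrN !norm_orthonormal expr1n gtrDl ltr10.
Qed.

End OrthogonalSeries.
End InnerProduct.

(** * Derivations on the compact operators *)

Section Derivations.
Context {R : realType} {H : completeNormedModType R[i]}.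
Variable dot : {dot H for Num.conj}.
Hypothesis norm_dot : forall u : H, `|u| ^+ 2 = dot u u.
Hypothesis span_proper : forall t : seq H, exists v, ~ seq_span t v.

Lemma unit_orthogonal (s : seq H) :
  exists2 e, dot e e = 1 & forall t, seq_span s t -> dot t e = 0.
Proof.
have [v /(span_separation dot)[e es /dot_self_neq0 e0]] := span_proper s.
exists (`|e|^-1 *: e); last by move=> t /es te; rewrite linearZr_LR /= te mulr0.
by rewrite -norm_dot normrZ normfV normr_id mulVf ?expr1n// normr_eq0.
Qed.

Lemma orthonormal_sequence :
  exists h : nat -> H, forall i j, dot (h i) (h j) = (i == j)%:R.
Proof.
have [s|h hP] := @sequential_choice _
    (fun s e => dot e e = 1 /\ forall t, seq_span s t -> dot t e = 0).
  by have [e] := unit_orthogonal s; exists e.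
have orth i j : (i < j)%N -> dot (h i) (h j) = 0.
  move=> ij; apply: (hP j).2; apply: span_mem; apply/mapP; exists i => //.
  by rewrite mem_iota add0n.
exists h => i j; have [ij|ji|->] := ltngtP i j.
- exact: orth.
- by rewrite (dotC dot) orth// conjC0.
- exact: (hP j).1.
Qed.

(* Reading D (u e^* ) at e solves D a = a x - x a for x, up to a multiple of
   the identity. *)
Lemma derivation_implemented (D : (H -> H) -> (H -> H)) (I : set (H -> H)) :
    I `<=` bounded_op -> derivation (compact_op H) I D ->
  exists2 x : H -> H, bounded_op x &
    forall a, compact_op H a -> D a = (a \o x) - (x \o a).
Proof.
move=> Ib [DI DL [M DM] DD].
have [e ee _] := unit_orthogonal [::].
have cr u : compact_op H (rank_one dot u e) by exact: rank_one_compact.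
have e1 : `|e| = 1 by apply/eqP; rewrite -(@eqrXn2 _ 2)// norm_dot ee expr1n.
(* The sign comes from the Leibniz rule for [a \o rank_one dot u e] at [e], which gives [D a u] as
   [D (rank_one dot (a u) e) e - a (D (rank_one dot u e) e)]. *)
exists (fun u => - D (rank_one dot u e) e).
  split=> [c u v|].
    have -> : rank_one dot (c *: u + v) e = c *: rank_one dot u e + rank_one dot v e.
      apply/funext => w; rewrite -[RHS]/(c *: (dot w e *: u) + dot w e *: v).
      by rewrite /rank_one scalerDr !scalerA mulrC.
    by rewrite DL// opprD -scalerN.
  (* The bound [M] of a derivation carries no sign, hence the absolute value. *)
  exists `|M| => u; rewrite normrN.
  have Db := Ib _ (DI _ (cr u)).
  rewrite (le_trans (opnormP _ Db))// e1 mulr1 -(normRe u) -realcM lecR.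
  rewrite (le_trans (DM _ (cr u)))//.
  rewrite (le_trans (ler_wpM2r (opnorm_ge0 (cr u).1) (ler_norm M)))//.
  apply: ler_wpM2l => //; apply: opnorm_le => [|v].
    by rewrite -lecR normRe; exact: normr_ge0.
  by rewrite normRe (le_trans (rank_one_norm norm_dot _ _ _))// e1 mulr1.
move=> a ac; apply/funext => u; have [[aL _] _] := ac.
have ar : a \o rank_one dot u e = rank_one dot (a u) e.
  by apply/funext => v; rewrite /rank_one /= linear_funZ.
have := DD _ _ ac (cr u); rewrite ar => /(congr1 (@^~ e)) Dau.
have -> : ((a \o (fun u => - D (rank_one dot u e) e)) -
    ((fun u => - D (rank_one dot u e) e) \o a)) u =
    D (rank_one dot (a u) e) e - a (D (rank_one dot u e) e).
  rewrite -[LHS]/(a (- D (rank_one dot u e) e) - - D (rank_one dot (a u) e) e).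
  by rewrite -scaleN1r linear_funZ// scaleN1r opprK addrC.
rewrite Dau -[X in X - _]/(a (D (rank_one dot u e) e) + D a (dot e e *: u)).
by rewrite ee scale1r addrC addKr.
Qed.

(** * Compact operators with an infinite-rank commutator *)

Section Triangular.
Variable x : H -> H.
Hypothesis xL : linear x.
Hypothesis x_nonscalar : forall (c : R[i]) s, ~ (forall u, seq_span s (x u - c *: u)).

(** For a history of pairs [(u, e)], these are the generators of the space [F_n]. *)
Let orbit (s : seq (H * H)) := flatten [seq [:: q.1; x q.1] | q <- s].

(** Without a suitable [u], [x] would be locally scalar, hence scalar, modulo the span of [F]. The
    vector [e] then separates [x u] from the span of [u :: F]. *)
Lemma triangular_step (s : seq (H * H)) : exists p : H * H,
  [/\ ~ seq_span (orbit s) p.1,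
      forall v, seq_span (p.1 :: orbit s) v -> dot v p.2 = 0,
      dot (x p.1) p.2 != 0 & `|p.1| * `|p.2| <= 2 ^- (size s).+1].
Proof.
set F := orbit s.
have [u [uF xuF]] : exists u, ~ seq_span F u /\ ~ seq_span (u :: F) (x u).
  apply: contrapT => no_u.
  have [u uF|c] := @locally_scalar_mod_span _ _ x F xL span_proper.
    by apply: contrapT => xuF; apply: no_u; exists u.
  exact: x_nonscalar.
have [e eF xue] := span_separation dot xuF.
have d0 : 0 < `|u| * `|e|.
  rewrite mulr_gt0 ?normr_gt0//; last exact: dot_self_neq0 xue.
  apply/eqP => u0; apply: uF; rewrite u0; exact: (span_subspace F).1.
(* Rescaling [e] by [d] keeps its orthogonality relations and makes the series summable. *)
pose d := 2 ^- (size s).+1 / (`|u| * `|e|).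
have d_gt0 : 0 < d by rewrite divr_gt0// invr_gt0 exprn_gt0.
exists (u, d *: e); split=> //= [v /eF ve||].
- by rewrite linearZr_LR /= ve mulr0.
- by rewrite linearZr_LR /= mulf_neq0// conjC_eq0 gt_eqF.
- by rewrite normrZ gtr0_norm// mulrCA /d divfK// gt_eqF.
Qed.

Lemma commutator_infinite_rank : exists2 a, compact_op H a &
  ~ finite_dim (range ((a \o x) - (x \o a))).
Proof.
have [p pP] := sequential_choice triangular_step.
pose u n := (p n).1; pose e n := (p n).2; pose F n := orbit (mkseq p n).
have FE n j : (j < n)%N -> u j \in F n /\ x (u j) \in F n.
  move=> jn; have jm : [:: u j; x (u j)] \in [seq [:: q.1; x q.1] | q <- mkseq p n].
    by apply/map_f/mapP; exists j => //; rewrite mem_iota add0n.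
  by split; apply/flattenP; exists [:: u j; x (u j)] => //; rewrite !inE eqxx ?orbT.
have FS n := span_subspace (F n).
have u_out n : ~ seq_span (F n) (u n) by have [] := pP n.
have e_orth n v : seq_span (u n :: F n) v -> dot v (e n) = 0.
  by have [_ + _ _] := pP n; exact.
have we n : `|u n| * `|e n| <= 2 ^- n.+1.
  by have [_ _ _] := pP n; rewrite size_mkseq.
have [a ac aP] := rank_one_series_compact norm_dot we; exists a => //.
have a_sum k v : (forall n, (k <= n)%N -> dot v (e n) = 0) ->
    a v = rank_one_sum dot u e k v.
  move=> vk; apply: (cvg_eventually_eq (N := k) (aP v)) => n kn.
  exact: rank_one_sum_const.
(* [u k] is orthogonal to [e k] by choice and to each later [e n] because it belongs to [F n]. *)
have au k : a (u k) = rank_one_sum dot u e k (u k).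
  apply: a_sum => n kn; apply: e_orth; apply: span_mem; rewrite inE.
  by have [->|nk] := eqVneq k n; rewrite ?eqxx// (FE n k _).1 ?orbT// ltn_neqAle nk.
(* [x (u k)] is orthogonal only to the [e n] with [k < n]; the extra term is the diagonal entry. *)
have axu k : a (x (u k)) =
    rank_one_sum dot u e k (x (u k)) + dot (x (u k)) (e k) *: u k.
  rewrite (a_sum k.+1) ?rank_one_sumS// => n kn; apply: e_orth; apply: span_mem.
  by rewrite inE (FE n k kn).2 orbT.
have sum_in k v : seq_span (F k) (rank_one_sum dot u e k v).
  apply: subspace_sum => // i _; apply: subspaceZ => //; apply: span_mem.
  exact: (FE k i (ltn_ord i)).1.
have xsum_in k v : seq_span (F k) (x (rank_one_sum dot u e k v)).
  have -> : x (rank_one_sum dot u e k v) = \sum_(i < k) dot v (e i) *: x (u i).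
    rewrite linear_fun_sum//.
    by apply: eq_bigr => i _; exact: linear_funZ.
  apply: subspace_sum => // i _; apply: subspaceZ => //; apply: span_mem.
  exact: (FE k i (ltn_ord i)).2.
pose g := (a \o x) - (x \o a).
have gE k : exists2 t, seq_span (F k) t & g (u k) = dot (x (u k)) (e k) *: u k + t.
  exists (rank_one_sum dot u e k (x (u k)) - x (rank_one_sum dot u e k (u k))).
    exact: subspaceB.
  rewrite -[LHS]/(a (x (u k)) - x (a (u k))) axu au.
  by rewrite addrA (addrC (_ *: u k)).
have Fmono j k : (j <= k)%N -> seq_span (F j) `<=` seq_span (F k).
  move=> jk; apply: spanS => v /flattenP[_ /mapP[_ /mapP[i + ->] ->]].
  rewrite mem_iota add0n => ij; have ik := leq_trans ij jk.
  by rewrite !inE => /orP[] /eqP ->; apply: span_mem; have [] := FE k i ik.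
move=> /finite_dimE[s gs].
apply: (@independent_sequence_unbounded _ _ (g \o u) s); last first.
  by move=> k; rewrite -gs; exists (u k).
move=> k gk; have [t tF gkE] := gE k.
have xue : dot (x (u k)) (e k) != 0 by have [] := pP k.
(* All earlier [g (u j)] lie in the span of [F k]; if [g (u k)] depended on them, dividing by the
   diagonal entry would put [u k] there too. *)
apply: (u_out k); rewrite -[u k]scale1r -(mulVf xue) -scalerA.
apply: subspaceZ => //; rewrite -(addrK t (_ *: u k)) -gkE.
apply: subspaceB => //; move: gk; apply: span_min => // _ /mapP[j + ->].
rewrite mem_iota add0n => jk /=; have [t' t'F ->] := gE j.
apply: subspaceD => //; last exact: (Fmono _ _ (ltnW jk)).
by apply: subspaceZ => //; apply: span_mem; exact: (FE k j jk).1.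
Qed.

End Triangular.

(** Scalars commute with every operator, so [x - c] implements the same derivation as [x]; it has
    finite rank as soon as its values stay in one finite span. *)
Lemma finite_rank_derivation_inner (D : (H -> H) -> (H -> H)) :
  derivation (compact_op H) (finite_rank_op H) D ->
  inner_derivation (compact_op H) (finite_rank_op H) D.
Proof.
move=> DD; have [DF _ _ _] := DD.
have [|x xb Dx] := derivation_implemented _ DD; first by move=> a [].
have [xL _] := xb.
have [[c [s xs]]|x_ns] := pselect
    (exists (c : R[i]) s, forall u, seq_span s (x u - c *: u)).
  have yE : (- c) *: @idfun H + x = fun u => x u - c *: u.
    by apply/funext => u; rewrite addrC -scaleNr.
  have yb : bounded_op (fun u => x u - c *: u).
    by rewrite -yE; apply: bounded_op_lin => //; exact: bounded_op_id.
  exists (fun u => x u - c *: u).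
    split=> //; apply/finite_dimE; apply: (@subspace_span _ _ _ s).
      by apply: linear_range_subspace; case: yb.
    by move=> _ [u _ <-].
  move=> a ac; have [[aL _] _] := ac; rewrite Dx//; apply/funext => u.
  rewrite -[RHS]/(a (x u - c *: u) - (x (a u) - c *: a u)).
  by rewrite (linear_funB _ _ aL) (linear_funZ _ _ aL) opprB addrA subrK.
have [|a ac []] := commutator_infinite_rank xL.
  by move=> c s xs; apply: x_ns; exists c, s.
by rewrite -Dx//; case: (DF _ ac).
Qed.

(** Compact operators form a two-sided ideal among bounded ones, and each of the two products
    contributes one [M] to the bound. *)
Lemma commutator_derivation (T : H -> H) : bounded_op T ->
  derivation (compact_op H) (compact_op H) (fun a => (a \o T) - (T \o a)).
Proof.
move=> Tb; have [TL [M M0 TM]] := (bounded_opP _).1 Tb; split.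
- move=> a ac; rewrite addrC -scaleN1r.
  by apply: compact_op_lin; [exact: compact_op_compl|exact: compact_op_compr].
- move=> c a b _ _; apply/funext => u.
  rewrite -[LHS]/(c *: a (T u) + b (T u) - T (c *: a u + b u)) TL opprD addrACA.
  by rewrite -scalerBr.
- exists (M + M) => a ac; have ab := ac.1.
  have a0 := opnorm_ge0 ab; apply: opnorm_le => [|u].
    by rewrite mulr_ge0// addr_ge0.
  rewrite -[X in `|X|]/(a (T u) - T (a u)) (le_trans (ler_normB _ _))//.
  rewrite mulrDl realcD mulrDl lerD//.
    rewrite (le_trans (opnormP _ ab))// mulrC realcM mulrAC.
    by apply: ler_wpM2r; rewrite ?lecR.
  rewrite (le_trans (TM _))// realcM -mulrA; apply: ler_wpM2l; rewrite ?lecR//.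
  exact: opnormP.
- move=> a b [[aL _] _] _; apply/funext => u.
  rewrite -[LHS]/(a (b (T u)) - T (a (b u))).
  rewrite -[RHS]/(a (b (T u) - T (b u)) + (a (T (b u)) - T (a (b u)))).
  by rewrite (linear_funB _ _ aL) addrA subrK.
Qed.

Lemma inner_derivation_scalar (T x : H -> H) :
    (forall a, compact_op H a -> (a \o T) - (T \o a) = (a \o x) - (x \o a)) ->
  exists c : R[i], forall u, x u = T u - c *: u.
Proof.
move=> Tx; have [e ee _] := unit_orthogonal [::].
(* Evaluating both commutators with [rank_one dot u e] at the unit vector [e] leaves exactly this
   multiple of [u]. *)
exists (dot (T e) e - dot (x e) e) => u.
have /(congr1 (@^~ e)) := Tx _ (rank_one_compact norm_dot u e).
rewrite -[LHS]/(dot (T e) e *: u - T (dot e e *: u)).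
rewrite -[RHS]/(dot (x e) e *: u - x (dot e e *: u)) ee !scale1r => /eqP.
rewrite subr_eq => /eqP TE; rewrite scalerBl TE.
by rewrite -[X in _ - X]addrA (addrC (_ - x u)) addrA subrK subKr.
Qed.

Lemma non_inner_derivation : exists D : (H -> H) -> (H -> H),
  derivation (compact_op H) (compact_op H) D /\
  ~ inner_derivation (compact_op H) (compact_op H) D.
Proof.
have [h hP] := orthonormal_sequence.
(* Both halves are infinite, so the eigenvalue argument applies to each: [T] fixes every [e n] and
   kills every [f n]. *)
pose e n := h n.*2; pose f n := h n.*2.+1.
have eP i j : dot (e i) (e j) = (i == j)%:R.
  by rewrite hP eqn_leq !leq_double -eqn_leq.
have fP i j : dot (f i) (f j) = (i == j)%:R.
  by rewrite hP eqSS eqn_leq !leq_double -eqn_leq.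
have [T [TL T1 PT]] := orthogonal_series_bounded norm_dot eP.
have Te j : T (e j) = e j.
  apply: (cvg_eventually_eq (N := j.+1) (PT _)) => n jn.
  rewrite /rank_one_sum (bigD1 (Ordinal jn))//= /rank_one eP eqxx scale1r.
  rewrite big1 ?addr0// => k; rewrite -val_eqE /= eP eq_sym => /negbTE ->.
  by rewrite scale0r.
have Tf j : T (f j) = 0.
  apply: (cvg_eventually_eq (N := 0) (PT _)) => n _.
  rewrite (rank_one_sum_const _ (leq0n n)) ?rank_one_sum0// => k _.
  suff /negbTE oe : j.*2.+1 != k.*2 by rewrite hP oe.
  by apply/eqP => /(congr1 odd); rewrite /= !odd_double.
have Tb : bounded_op T by split=> //; exists 1 => u; rewrite mul1r.
exists (fun a => (a \o T) - (T \o a)); split; first exact: commutator_derivation.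
move=> [x xc /inner_derivation_scalar[c xE]].
have c1 : 1 - c = 0.
  apply: (compact_op_eigenvalue norm_dot eP xc) => n.
  by rewrite xE Te scalerBl scale1r.
have c0 : - c = 0.
  apply: (compact_op_eigenvalue norm_dot fP xc) => n.
  by rewrite xE Tf sub0r scaleNr.
by move: c1; rewrite c0 addr0 => /eqP; rewrite oner_eq0.
Qed.

End Derivations.

Unset Implicit Arguments.

Theorem theorem4p1 (R : realType) (H : completeNormedModType R[i])
    (dot : {dot H for Num.conj})
    (norm_dot : forall u : H, `|u| ^+ 2 = dot u u)
    (Hsep : separable H)
    (Hinf : ~ finite_dim [set: H]) :
  (forall D : (H -> H) -> (H -> H),
     derivation (compact_op H) (finite_rank_op H) D ->
     inner_derivation (compact_op H) (finite_rank_op H) D) /\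
  (exists D : (H -> H) -> (H -> H),
     derivation (compact_op H) (compact_op H) D /\
     ~ inner_derivation (compact_op H) (compact_op H) D).
Proof.
(* Infinite dimension in the form used by all the choices above. *)
have span_proper (t : seq H) : exists v, ~ seq_span t v.
  apply: contrapT => tH; apply/Hinf/finite_dimE; exists t.
  rewrite eqEsubset; split=> // v _.
  by apply: contrapT => tv; apply: tH; exists v.
split; last exact: non_inner_derivation norm_dot span_proper.
by move=> D; exact: (finite_rank_derivation_inner norm_dot span_proper).
Qed.
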